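(* For every integer $n\ge 3$ there exist constants $C=C(n)>0$ and $\delta=\delta(n)\in(0,1)$, depending only on $n$, such that for every integer $m\ge 2$, if $T$ is a uniform spanning tree of the wired cylindrical graph $G_{n,m}^{\mathrm s}$, then for every integer $l\ge 1$, $$\mathbb{P}\bigl(\,|\mathrm{Slash}_{\mathrm{LR}}(T)|>l\,\bigr)\;\le\; C\,\delta^{\,l}.$$
   Context: For $n\ge 3$, $m\ge 2$, the cylindrical graph $G_{n,m}=C_n\times P_m$ has vertex set $\{(i,j): i\in\mathbb{Z}_n,\ j\in\{0,\dots,m-1\}\}$ and edges $\{(i,j),(i+1,j)\}$ ($i\in\mathbb{Z}_n$, $0\le j\le m-1$) and $\{(i,j),(i,j+1)\}$ ($i\in\mathbb{Z}_n$, $0\le j\le m-2$). Its rings are $R_k=\{(i,k): i\in\mathbb{Z}_n\}$, $k=0,\dots,m-1$. The wired cylindrical graph $G_{n,m}^{\mathrm s}$ is obtained from $G_{n,m}$ by adding one new vertex $s$ (the sink) and the edges $\{s,v\}$ for all $v\in R_0\cup R_{m-1}$. Vertices of $G_{n,m}$ are called real vertices. A uniform spanning tree of a finite connected graph is a spanning tree chosen uniformly among all its spanning trees. Let $T$ be a spanning tree of $G_{n,m}^{\mathrm s}$. For each real vertex $v$ there is a unique path in $T$ from $v$ to $s$. If the last real vertex of this path before $s$ lies in $R_0$, $v$ is left-labelled; if it lies in $R_{m-1}$, $v$ is right-labelled. Let $V_l(T)$ and $V_r(T)$ be the sets of left- and right-labelled vertices. The LR--Slash of $T$ is $$\mathrm{Slash}_{\mathrm{LR}}(T)=\bigl\{\{u,v\}\in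 E(G_{n,m}): u\in V_l(T),\,v\in V_r(T)\ \text{ or }\ u\in V_r(T),\,v\in V_l(T)\bigr\},$$ and $|\mathrm{Slash}_{\mathrm{LR}}(T)|$ is its number of elements. *)

(* Defs.v *)
From mathcomp Require Import all_boot all_order all_algebra.
From mathcomp Require Import reals.

Set Implicit Arguments.
Unset Strict Implicit.
Unset Printing Implicit Defensive.

Import Order.TTheory GRing.Theory Num.Theory.

(* A finite simple graph on V is given by its edge set E : {set {set V}}, whose
   members are meant to have exactly two elements. *)

Definition adj (V : finType) (E : {set {set V}}) : rel V :=
  [rel x y | [set x; y] \in E].

Definition connected_graph (V : finType) (E : {set {set V}}) : bool :=
  [forall x, forall y, connect (adj E) x y].

(* A cycle has pairwise distinct vertices, hence at most #|V| of them; this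
   bound lets the quantification range over a finite type. *)
Definition acyclic_graph (V : finType) (E : {set {set V}}) : bool :=
  ~~ [exists k : 'I_#|V|.+1, exists c : k.-tuple V,
        (2 < k) && ucycleb (adj E) c].

Definition spanning_trees (V : finType) (E : {set {set V}}) :
    {set {set {set V}}} :=
  [set T : {set {set V}} | [&& T \subset E, connected_graph T & acyclic_graph T]].

(* x :: p is the sequence of vertices of a self-avoiding path from x to y. *)
Definition simple_path (V : finType) (E : {set {set V}}) (x y : V)
    (p : seq V) : bool :=
  [&& path (adj E) x p, uniq (x :: p) & last x p == y].

Definition cyl_vertex (n m : nat) : finType := ('I_n * 'I_m)%type.

Definition axial_step (n m : nat) (u v : cyl_vertex n m) : bool :=
  (v.1 == u.1) && (v.2 == u.2.+1 :> nat).

(* ordS is the cyclic successor of 'I_n, i.e. i + 1 modulo n. *)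
Definition cyl_edges (n m : nat) : {set {set cyl_vertex n m}} :=
  [set [set v; (ordS v.1, v.2)] | v : cyl_vertex n m] :|:
  [set [set u; v] | u : cyl_vertex n m, v : cyl_vertex n m in axial_step u].

Definition ring_of (n m k : nat) : {set cyl_vertex n m} :=
  [set v : cyl_vertex n m | v.2 == k :> nat].

(* The sink s is None and the real vertex v is Some v. *)
Definition wired_vertex (n m : nat) : finType := option (cyl_vertex n m).

Definition wired_edges (n m : nat) : {set {set wired_vertex n m}} :=
  [set Some @: (e : {set cyl_vertex n m}) | e in cyl_edges n m] :|:
  [set [set None; Some v] | v in ring_of n m 0 :|: ring_of n m m.-1].

(* w is the last real vertex before the sink on a simple path of T from v to
   the sink; such a path is unique when T is a spanning tree. It has fewer than
   #|wired_vertex n m| vertices after v. *)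
Definition exits_at (n m : nat) (T : {set {set wired_vertex n m}})
    (v w : cyl_vertex n m) : bool :=
  [exists k : 'I_#|wired_vertex n m|, exists p : k.-tuple (wired_vertex n m),
     simple_path T (Some v) None p &&
     (last None (belast (Some v) p) == Some w)].

Definition left_labelled (n m : nat) (T : {set {set wired_vertex n m}}) :
    {set cyl_vertex n m} :=
  [set v : cyl_vertex n m | [exists w in ring_of n m 0, exits_at T v w]].

Definition right_labelled (n m : nat) (T : {set {set wired_vertex n m}}) :
    {set cyl_vertex n m} :=
  [set v : cyl_vertex n m | [exists w in ring_of n m m.-1, exits_at T v w]].

(* Edges are unordered, so the two cases u left, v right and u right, v left
   give the same family of pairs. *)
Definition slash_LR (n m : nat) (T : {set {set wired_vertex n m}}) :
    {set {set cyl_vertex n m}} :=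
  cyl_edges n m :&:
  [set [set u; v] | u in left_labelled T, v in right_labelled T].

(* Probability of the event P under the uniform law on the finite set A, which
   is meant to be nonempty. *)
Definition unif_prob (R : realType) (X : finType) (A : {set X}) (P : pred X) :
    R :=
  (#|[set x in A | P x]|%:R / #|A|%:R)%R.

(* Main.v *)
(* Encode a spanning tree by the map sending each real vertex to the direction
   of its first step towards the sink.  If the slash is long, there are rings
   p - 1, ..., p + k that all meet both labels.  In ring p and in an arbitrary
   set of the rings p + 1, ..., p + k, redirect every vertex around the ring to
   the last vertex at which a right-exiting path visits it; the result is again
   a spanning tree.  All rings from p on become right-labelled while ring p - 1
   keeps a left-labelled vertex, so p can be read off the new tree.  So can the
   set of redirected rings: an untouched bichromatic ring never has all its
   vertices but one pointing around.  Hence, knowing what the redirected rings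
   looked like before, one recovers the old tree.  With c = 4^n configurations
   per ring this gives an injection showing that the proportion of trees with
   such a band is at most c (c / (c + 1))^k. *)

Require Import Defs.
From mathcomp Require Import all_boot all_order all_algebra.
From mathcomp Require Import reals.
From mathcomp Require Import boolp zify ring lra.

Set Implicit Arguments.
Unset Strict Implicit.
Unset Printing Implicit Defensive.

Import Order.TTheory GRing.Theory Num.Theory.

(** * Elementary facts on graphs *)

Lemma set2_eq (T : finType) (a b c d : T) : [set a; b] = [set c; d] ->
  (a = c /\ b = d) \/ (a = d /\ b = c).
Proof.
move=> E; have := set21 a b; have := set22 a b; rewrite E => ina inb.
move: (set21 c d) (set22 c d) ina inb; rewrite -{1 2}E !inE.
by do 4![case/orP=> /eqP ?]; subst; auto.
Qed.

Section Graphs.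

Variable V : finType.
Implicit Types (E : {set {set V}}) (x y : V).

Lemma adj_sym E : symmetric (adj E).
Proof. by move=> x y; rewrite /adj /= setUC. Qed.

(* An edge of E' outside E closes a cycle with the path of E joining its ends. *)
Lemma connected_sub_acyclic E E' x y : E \subset E' -> connected_graph E ->
  acyclic_graph E' -> x != y -> [set x; y] \in E' -> [set x; y] \in E.
Proof.
move=> /subsetP sEE' E_conn E'_acyc ne_xy E'xy; apply: contraLR E'_acyc => nExy.
rewrite negbK; have /connectP[p0 p0_path] : connect (adj E) x y.
  by move/forallP: E_conn => /(_ x)/forallP/(_ y).
case: (shortenP p0_path) => p p_path p_uniq _ Ey;
rewrite {y}Ey in ne_xy E'xy nExy.
have size_le : (size p).+1 < #|V|.+1.
  by have /card_uniqP /= <- := p_uniq; rewrite ltnS max_card.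
apply/existsP; exists (Ordinal size_le).
apply/existsP; exists (in_tuple (x :: p)).
have long_p : 1 < size p.
  case: p p_path nExy ne_xy {p_uniq size_le E'xy} => [|z [|]] //=.
    by rewrite eqxx.
  by rewrite andbT /adj /= => ->.
rewrite ltnS long_p /ucycleb p_uniq andbT /=.
have /sub_path pE' : subrel (adj E) (adj E') by move=> u v /sEE'.
by rewrite rcons_path pE' // adj_sym [adj _ _ _]E'xy.
Qed.

End Graphs.

(** * Direction maps and the exits of their paths *)

Section DirectionMaps.

Variables n m : nat.
Implicit Types (v w x y : cyl_vertex n m) (b : bool) (q : nat).

Definition level v : nat := v.2.

Lemma level_lt v : level v < m. Proof. exact: ltn_ord. Qed.

(* (false, b) is a step along the ring, (true, b) a step across rings; b says
   whether the coordinate increases.  Stepping off either end leads to the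
   sink, so that every real vertex has all four directions. *)
Definition direction : finType := (bool * bool)%type.

Definition move v (d : direction) : wired_vertex n m :=
  match d with
  | (false, false) => Some (ord_pred v.1, v.2)
  | (false, true) => Some (ordS v.1, v.2)
  | (true, false) =>
      if v.2 == 0 :> nat then None else omap (pair v.1) (insub v.2.-1)
  | (true, true) => omap (pair v.1) (insub v.2.+1)
  end.

Definition dirmap : finType := {ffun cyl_vertex n m -> direction}.
Implicit Types (f g : dirmap) (P : pred nat).

Variant move_spec v : direction -> wired_vertex n m -> Prop :=
  | MoveAround b w of level w = level v &
      w.1 = (if b then ordS v.1 else ord_pred v.1) :
      move_spec v (false, b) (Some w)
  | MoveUp w of level w = (level v).+1 & w.1 = v.1 :
      move_spec v (true, true) (Some w)
  | MoveDown w of level v = (level w).+1 & w.1 = v.1 :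
      move_spec v (true, false) (Some w)
  | MoveOutUp of (level v).+1 = m : move_spec v (true, true) None
  | MoveOutDown of level v = 0 : move_spec v (true, false) None.

Lemma moveP v d : move_spec v d (move v d).
Proof.
have lt_v := level_lt v; rewrite /move -[nat_of_ord v.2]/(level v).
case: d => [[] []]; last 2 first.
- by constructor.
- by constructor.
- case: insubP => [i _ Ei | ] /=; first exact: MoveUp.
  by rewrite -leqNgt => le_m; apply: MoveOutUp; lia.
- have [E0 | n0] := eqVneq; first exact: MoveOutDown.
  case: insubP => [i _ Ei | ] /=.
    by apply: MoveDown => //=; rewrite [level (_, _)]Ei; lia.
  by rewrite -leqNgt; lia.
Qed.

Lemma move_out v d : move v d = None ->
  d = (true, d.2) /\ level v = if d.2 then m.-1 else 0.
Proof. by case: moveP => //= <-. Qed.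

Lemma move_raise v d w :
  move v d = Some w -> level v < level w -> d = (true, true).
Proof. by case: moveP => // [b w'|w'] E _ [<-]; lia. Qed.

Lemma move_level v d w :
  move v d = Some w -> level v <= (level w).+1 /\ level w <= (level v).+1.
Proof. by case: moveP => // [b w'|w'|w'] E _ [<-]; lia. Qed.

(** An inductive predicate, so the path followed is finite and [valid] excludes cycles. [P] confines
    the rings visited; [b] is [true] for an exit from ring [m - 1]. *)
Inductive exits f P b : cyl_vertex n m -> Prop :=
  | exits_here v of P (level v) & move v (f v) = None & (f v).2 = b :
      exits f P b v
  | exits_step v w of P (level v) & move v (f v) = Some w & exits f P b w :
      exits f P b v.

Definition valid f := forall v, exists b, exits f predT b v.

Lemma exits_at_start f P b v : exits f P b v -> P (level v).
Proof. by case. Qed.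

Lemma exits_sub f P b v : exits f P b v -> exits f predT b v.
Proof.
elim=> {}v; first by move=> _; apply: exits_here.
by move=> w _ /exits_step s _; apply: s.
Qed.

Lemma exits_next f P b v w :
  exits f P b v -> move v (f v) = Some w -> exits f P b w.
Proof. by case=> {}v => [_ -> // | w' _ -> Ew' [<-]]. Qed.

Lemma exits_inj f P b c v : exits f P b v -> exits f P c v -> b = c.
Proof.
elim=> {}v; first by move=> _ + <- Ec; case: Ec => // {}v w _ ->.
by move=> w _ E _ IH Ec; apply: IH; apply: exits_next Ec E.
Qed.

(* x is the last visit of ring q by a path that exits at ring 0. *)
Lemma last_visit_down f v q :
  exits f predT false v -> q < level v ->
  exists2 x : cyl_vertex n m,
    level x = q & exits f (fun k => k <= q) false x.
Proof.
move=> Ev.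
have: exits f (fun k => k <= q) false v \/ exists2 x : cyl_vertex n m,
    level x = q & exits f (fun k => k <= q) false x.
  elim: Ev => {}v => [_ E0 Ef | w _ E _ [Ew | [x Ex1 Ex2]]].
  - left; apply: exits_here => //.
    by have [_ ->] := move_out E0; rewrite Ef.
  - have Pw := exits_at_start Ew; have [le_vw _] := move_level E.
    have [le_vq | lt_qv] := leqP (level v) q; first by left; apply: exits_step Ew.
    by right; exists w => //; lia.
  - by right; exists x.
by case=> // /exits_at_start; rewrite leqNgt => /negP.
Qed.

(* y is the last vertex in ring q of a path that exits at ring m - 1. *)
Definition last_up f q y : Prop :=
  [/\ level y = q :> nat, f y = (true, true) &
      forall w, move y (true, true) = Some w -> exits f (fun k => q < k) true w].

(** The last step from a ring at most [q] to one above it starts in ring [q] exactly, since a step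
    changes the level by at most one. For [q = m - 1] that step leads to the sink. *)
Lemma last_visit_up f v q :
  exits f predT true v -> level v <= q -> q < m -> exists y, last_up f q y.
Proof.
move=> Ev le_vq lt_qm.
have: exits f (fun k => q < k) true v \/ exists y, last_up f q y.
  elim: Ev => {le_vq}v => [_ E0 Ef | w _ E _ [Ew | [y Ey]]].
  - have [lt_qv | le_vq] := ltnP q (level v); first by left; apply: exits_here.
    have [Ed] := move_out E0; rewrite Ef in Ed * => El.
    by right; exists v; split=> [||w]; [lia | | rewrite -Ed E0].
  - have Pw := exits_at_start Ew; have [_ le_wv] := move_level E.
    have [lt_qv | le_vq] := ltnP q (level v); first by left; apply: exits_step Ew.
    have Ed := move_raise E (leq_ltn_trans le_vq Pw).
    by right; exists v; split=> // [|w']; [lia | rewrite -Ed E => -[<-]].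
  - by right; exists y.
by case=> // /exits_at_start; rewrite ltnNge le_vq.
Qed.

(** * Rings pointing around, and rerouting *)

Lemma vertex_ext v w : v.1 = w.1 -> level v = level w -> v = w.
Proof. by case: v w => [i j] [i' j'] /= -> Ej; congr pair; apply: val_inj. Qed.

Definition around v : cyl_vertex n m := (ordS v.1, v.2).

Lemma level_around v : level (around v) = level v.
Proof. by []. Qed.

Lemma iter_ordS k (i : 'I_n) : iter k (@ordS n) i = (i + k) %% n :> nat.
Proof.
elim: k => [|k IH] /=; first by rewrite addn0 modn_small.
by rewrite IH -addn1 modnDml -addnA addn1.
Qed.

Lemma around_ind (Q : cyl_vertex n m -> Prop) x :
  Q x -> (forall v, level v = level x -> v != x -> Q (around v) -> Q v) ->
  forall v, level v = level x -> Q v.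
Proof.
move=> Qx QS v Ev.
have [k Ek]: exists k, iter k (@ordS n) v.1 = x.1.
  (* Congruent to [x.1 - v.1] modulo [n], with no truncation in the subtraction. *)
  exists (n - v.1 + x.1); apply: val_inj; rewrite /= iter_ordS addnA.
  by rewrite subnKC 1?ltnW // modnDl modn_small.
elim: k v Ev Ek => [|k IH] v Ev; last rewrite iterSr => Ek.
  by move=> /vertex_ext/(_ Ev) ->.
by have [->//|ne_vx] := eqVneq v x; apply: QS => //; apply: IH.
Qed.

(* Every tree path out of ring q passes through one vertex of it. *)
Definition wraps f q := exists2 x, level x = q &
  forall v, level v = q -> v != x -> f v = (false, true).

(** All paths from the ring run into its exceptional vertex [x] and share its exit. *)
Lemma wraps_monochromatic f q v w b c : wraps f q ->
  level v = q -> level w = q -> exits f predT b v -> exits f predT c w -> b = c.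
Proof.
case=> x Ex fx Ev Ew Eb Ec.
have toward u d: level u = q -> exits f predT d u -> exits f predT d x.
  rewrite -Ex; move: u; apply: around_ind => // u Eu ne_ux IH Ed.
  by apply: IH; apply: exits_next Ed _; rewrite fx // Eu.
exact: exits_inj (toward _ _ Ev Eb) (toward _ _ Ew Ec).
Qed.

(** [pick] fixes one vertex [y] per ring, which keeps its old direction [(true, true)]; a ring of
    [S] without such a vertex is left unchanged. *)
Definition reroute f (S : pred nat) : dirmap :=
  [ffun v => if S (level v) &&
       oapp (predC1 v) false [pick y | `[< last_up f (level v) y >]]
     then (false, true) else f v].

Lemma reroute_off f (S : pred nat) v : ~~ S (level v) -> reroute f S v = f v.
Proof. by rewrite ffunE => /negPf ->. Qed.

Lemma reroute_on f (S : pred nat) q : S q -> (exists y, last_up f q y) ->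
  exists2 y, last_up f q y & reroute f S y = (true, true) /\
    forall v, level v = q -> v != y -> reroute f S v = (false, true).
Proof.
move=> Sq [y0 y0P]; pose o := [pick y | `[< last_up f q y >]].
have [y [oE yP]]: exists y, o = Some y /\ last_up f q y.
  rewrite /o; case: pickP => [y /asboolP yP|/(_ y0)]; first by exists y.
  by move/asboolP: y0P => ->.
exists y => //; case: (yP) => Ey fy _; split=> [|v Ev ne_vy].
  by rewrite ffunE Ey -/o oE /= eqxx andbF.
by rewrite ffunE Ev -/o oE /= Sq eq_sym ne_vy.
Qed.

Section Reroute.

Variables (f : dirmap) (S : pred nat).
Hypothesis S_up : forall q, S q -> exists y, last_up f q y.

Local Notation f' := (reroute f S).

Lemma reroute_wraps q : S q -> wraps f' q.
Proof.
move=> Sq; have [y [Ey _ _] [_ fy]] := reroute_on Sq (S_up Sq).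
by exists y.
Qed.

(** Induction from the top ring down: the new path goes around to [y], moves up, and follows [f]
    above the ring until it exits at ring [m - 1] or enters a higher selected ring. *)
Lemma reroute_selected v : S (level v) -> exits f' predT true v.
Proof.
have [k] := ubnP (m - level v); elim: k v => // k IH v lt_k Sv.
have [y [Ey _ up_y] [f'y f'v]] := reroute_on Sv (S_up Sv).
move: up_y; move/esym: Ey => Ev; rewrite Ev in lt_k Sv f'v * => up_y.
move: v Ev; apply: around_ind => [|v Ev ne_vy IHv]; last first.
  by apply: exits_step IHv; rewrite // f'v.
case E: (move y (true, true)) => [w|]; last first.
  by apply: exits_here; rewrite // f'y.
apply: exits_step (_ : exits f' predT true w); rewrite ?f'y //.
elim: {E}(up_y w E) => {}w.
  move=> lt_yw E0 Ef; have [Sw|nSw] := boolP (S (level w)).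
    by apply: IH => //; have := level_lt w; lia.
  by apply: exits_here; rewrite ?reroute_off.
move=> x lt_yw Ew _ IHx; have [Sw|nSw] := boolP (S (level w)).
  by apply: IH => //; have := level_lt w; lia.
by apply: exits_step IHx; rewrite ?reroute_off.
Qed.

Lemma reroute_avoid P b v : (forall q, P q -> ~~ S q) ->
  exits f P b v -> exits f' predT b v.
Proof.
move=> PS; elim=> {}v; first by move=> /PS nS E0 Ef;
  apply: exits_here; rewrite ?reroute_off.
by move=> w /PS nS Ew _ IH; apply: exits_step IH; rewrite ?reroute_off.
Qed.

(** The new path follows the old one until it meets a ring of [S], from which it reaches the
    sink. *)
Lemma reroute_valid : valid f -> valid f'.
Proof.
move=> f_valid v; have [b] := f_valid v; elim=> {}v.
  move=> _ E0 Ef; have [Sv|nSv] := boolP (S (level v)).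
    by exists true; apply: reroute_selected.
  by exists b; apply: exits_here; rewrite ?reroute_off.
move=> w _ Ew _ [c IHw]; have [Sv|nSv] := boolP (S (level v)).
  by exists true; apply: reroute_selected.
by exists c; apply: exits_step IHw; rewrite ?reroute_off.
Qed.

Lemma reroute_beyond p v : valid f -> S p -> p <= level v ->
  exits f' predT true v.
Proof.
move=> f_valid Sp; have [b] := f_valid v; elim=> {}v.
  move=> _ E0 Ef le_pv; have [Sv|nSv] := boolP (S (level v)).
    exact: reroute_selected.
  apply: exits_here; rewrite ?reroute_off //.
  (* An exit at ring 0 would force [p = 0], but ring [p] is in [S]. *)
  have [_ El] := move_out E0; move: le_pv; rewrite El.
  by case: (f v).2 El => // El; rewrite leqn0 => /eqP p0;
    rewrite El -p0 Sp in nSv.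
move=> w _ Ew _ IHw le_pv; have [Sv|nSv] := boolP (S (level v)).
  exact: reroute_selected.
apply: exits_step (IHw _); rewrite ?reroute_off //.
(* From above ring [p], one step cannot skip ring [p]. *)
have [le_vw _] := move_level Ew.
have : p != level v by apply: contraNneq nSv => <-.
by lia.
Qed.

End Reroute.

(** * Bands of rings that meet both labels *)

Lemma last_up_exits f q y : last_up f q y -> exits f predT true y.
Proof.
case=> _ fy up_y; case E: (move y (true, true)) => [w|].
  by apply: exits_step (exits_sub (up_y w E)); rewrite ?fy.
by apply: exits_here; rewrite ?fy.
Qed.

(** The path of [u] climbs and that of [v] descends, so each of the rings [a] to [a.+1 + k] meets
    both labels. Ring [a.+1] is the first to be rerouted. *)
Definition band f k a := exists u v, [/\ level u = a, a.+1 + k <= level v,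
  exits f predT true u & exits f predT false v].

Lemma band_last_up f k a q : band f k a -> a <= q <= a.+1 + k ->
  exists y, last_up f q y.
Proof.
case=> u [v [Eu le_v Ru _]] /andP[le_aq le_qk].
by apply: last_visit_up Ru _ _; [rewrite Eu | have := level_lt v; lia].
Qed.

Lemma band_nwraps f k a q : band f k a -> a <= q <= a.+1 + k -> ~ wraps f q.
Proof.
move=> B q_bd wr; have [y yP] := band_last_up B q_bd.
have [Ey _ _] := yP; have := wraps_monochromatic wr Ey _ (last_up_exits yP).
case: B q_bd => u [v [_ le_v _ Lv]] /andP[_ le_qk] /(_ _ false).
have [<- | ne_qv] := eqVneq (level v) q; first by move/(_ v erefl Lv).
have [|x Ex /exits_sub Lx] := last_visit_down Lv (_ : q < level v); first by lia.
by move/(_ x Ex Lx).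
Qed.

(** * Encoding by rerouted maps and stored rings *)

Definition valids : {set dirmap} := [set f | `[< valid f >]].

Definition longs k : {set dirmap} :=
  [set f | `[< valid f /\ exists a, band f k a >]].

Definition ringmap : finType := {ffun 'I_n -> direction}.

Definition ring_restr f q : ringmap :=
  [ffun i => oapp (fun j : 'I_m => f (i, j)) (false, false) (insub q)].

Lemma ring_restrE f v : ring_restr f (level v) v.1 = f v.
Proof. by rewrite ffunE valK /=; case: v. Qed.

Definition selected k a (u : {ffun 'I_k -> option ringmap}) : pred nat :=
  fun q => (q == a.+1) || [exists i : 'I_k, (q == a.+2 + i) && ~~ u i].

Lemma selected_band k a (u : {ffun 'I_k -> option ringmap}) q :
  selected a u q -> a < q <= a.+1 + k.
Proof.
case/orP => [/eqP -> | /existsP[i /andP[/eqP-> _]]]; first by lia.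
by have := ltn_ord i; lia.
Qed.

Definition band_start k f : nat :=
  oapp val 0 [pick a : 'I_m | `[< band f k a >]].

Lemma band_startP k f a : band f k a -> band f k (band_start k f).
Proof.
move=> B; rewrite /band_start; case: pickP => [b /asboolP // | noB].
have lt_a : a < m by case: B => u [_ [<- _ _ _]]; apply: level_lt.
by have /asboolP := noB (Ordinal lt_a).
Qed.

(* The empty slots of u select the rings to reroute, and make room for what f
   was on them. *)
Definition encode k (fu : dirmap * {ffun 'I_k -> option ringmap}) :
    dirmap * (ringmap * {ffun 'I_k -> ringmap}) :=
  let: (f, u) := fu in let a := band_start k f in
  (reroute f (selected a u),
    (ring_restr f a.+1,
      [ffun i : 'I_k => odflt (ring_restr f (a.+2 + i)) (u i)])).

Section Encode.

Variable k : nat.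
Implicit Types (u t : {ffun 'I_k -> option ringmap}).

(* Ring a.+1 starts the part of the rerouted map that exits at ring m - 1. *)
Lemma reroute_start_le f g a c u t : valid f -> valid g ->
  band f k a -> band g k c ->
  reroute f (selected a u) = reroute g (selected c t) -> c <= a.
Proof.
move=> f_valid g_valid Bf Bg E; rewrite leqNgt; apply/negP => lt_ab.
have Sa : selected a u a.+1 by rewrite /selected eqxx.
(* Suppose [a < c]. A vertex of ring [c] that exits at ring 0 within rings up to [c] keeps its path
   when [g] is rerouted, yet lies in the part that rerouting [f] sends to ring [m - 1]. *)
have [w [v [_ le_v _ Lv]]] := Bg.
have [|x Ex Lx] := last_visit_down Lv (_ : c < level v); first by lia.
have: exits (reroute g (selected c t)) predT false x.
  apply: reroute_avoid Lx => q le_qb; apply/negP => /selected_band.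
  by rewrite ltnNge le_qb.
rewrite -E => Lx'.
have S_up q : selected a u q -> exists y, last_up f q y.
  by move=> /selected_band q_bd; apply: band_last_up Bf _; lia.
have Rx' : exits (reroute f (selected a u)) predT true x.
  by apply: reroute_beyond f_valid Sa _; rewrite ?Ex.
by have := exits_inj Lx' Rx'.
Qed.

(** Reads the empty slots of [u] off the new map: a rerouted ring wraps by construction, and an
    unselected ring of the band is as in [f], where it meets both labels. *)
Lemma selected_wraps f a u i : band f k a ->
  ~~ u i <-> wraps (reroute f (selected a u)) (a.+2 + i).
Proof.
move=> B; have i_lt := ltn_ord i; split=> [ui | wr].
  apply: reroute_wraps => [q /selected_band q_bd|].
    by apply: band_last_up B _; lia.
  by apply/orP; right; apply/existsP; exists i; rewrite eqxx.
apply/negP => ui; apply: (band_nwraps B (q := a.+2 + i)); first by lia.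
have nS : ~~ selected a u (a.+2 + i).
  apply/negP => /orP[/eqP|/existsP[j /andP[/eqP Ej]]]; first by lia.
  (* Distinct slots stand for distinct rings. *)
  by rewrite (_ : j = i) ?ui //; apply: val_inj => /=; lia.
case: wr => x Ex fx; exists x => // v Ev ne_vx.
by rewrite -(fx v) ?reroute_off // Ev.
Qed.

(** Decoding finds in turn the start, the empty slots, the contents of the full slots, and the old
    map: its selected rings are stored and the others are unchanged. *)
Lemma encode_inj : {in setX (longs k) setT &, injective (@encode k)}.
Proof.
move=> [f u] [g t]; rewrite !inE /= !andbT.
move=> /asboolP[f_valid [? /band_startP Bf]] /asboolP[g_valid [? /band_startP Bg]].
case; set a := band_start k f in Bf *; set c := band_start k g in Bg *.
rewrite -/a -/c => E Er Eu; have Eab : a = c.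
  apply/eqP; rewrite eqn_leq (reroute_start_le f_valid g_valid Bf Bg E).
  by rewrite (reroute_start_le g_valid f_valid Bg Bf (esym E)).
have Eui i : (u i : bool) = t i.
  apply: negb_inj; apply/idP/idP.
    by move/(selected_wraps _ _ Bf); rewrite E Eab => /(selected_wraps _ _ Bg).
  by move/(selected_wraps _ _ Bg); rewrite -E -Eab => /(selected_wraps _ _ Bf).
have Ei i := congr1 (fun h : {ffun _ -> _} => h i) Eu.
have Eut : u = t.
  apply/ffunP => i; have := Ei i; rewrite !ffunE.
  by have := Eui i; case: (u i) (t i) => [?|] [?|] //= _ ->.
congr pair => //; apply/ffunP => v.
have [Sv | nSv] := boolP (selected a u (level v)); last first.
  by rewrite -(reroute_off f nSv) E reroute_off // -Eab -Eut.
rewrite -(ring_restrE f) -(ring_restrE g); case/orP: Sv.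
  by move/eqP->; rewrite Er Eab.
case/existsP=> i /andP[/eqP -> ui].
by have := Ei i; rewrite 2!ffunE -Eut -Eab; case: (u i) ui => // _ /= ->.
Qed.

(** A slot of [u] has [4 ^ n + 1] states, a ring configuration or nothing; a code holds the new map
    and [k + 1] ring configurations. *)
Lemma card_longs :
  #|longs k| * (4 ^ n).+1 ^ k <= #|valids| * (4 ^ n * (4 ^ n) ^ k).
Proof.
have cR : #|ringmap| = 4 ^ n by rewrite card_ffun card_prod card_bool card_ord.
have sub : (@encode k) @: setX (longs k) setT \subset setX valids setT.
  apply/subsetP => _ /imsetP[[f u] + ->]; rewrite !inE /= !andbT.
  move=> /asboolP[f_valid [? /band_startP B]]; apply/asboolP.
  apply: reroute_valid => // q /selected_band q_bd.
  by apply: band_last_up B _; lia.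
have := subset_leq_card sub; rewrite (card_in_imset encode_inj) !cardsX !cardsT.
by rewrite card_ffun card_option card_prod cR card_ffun cR !card_ord.
Qed.

End Encode.


(** * Edges of the wired graph as moves *)

Lemma move_to_up v w :
  w.1 = v.1 -> level w = (level v).+1 -> move v (true, true) = Some w.
Proof. by case: w => i j /= -> Ej; rewrite /move -[_.+1]Ej valK. Qed.

Lemma move_to_down v w :
  w.1 = v.1 -> level v = (level w).+1 -> move v (true, false) = Some w.
Proof.
by case: w => i j /= -> Ej; rewrite /move -[nat_of_ord _]/(level v) Ej valK.
Qed.

Lemma move_rev v w d : move v d = Some w -> move w (d.1, ~~ d.2) = Some v.
Proof.
case: moveP => // [b w'|w'|w'] El E1 [?]; subst w'; rewrite /=.
- have Ev : v = (v.1, v.2) by case: v {El E1}.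
  have E2 : w.2 = v.2 by apply: val_inj.
  by case: b E1 => /= ->; rewrite E2 ?ordSK ?ord_predK -Ev.
- exact: move_to_down.
- exact: move_to_up.
Qed.

Lemma move_up_None v : level v = m.-1 -> move v (true, true) = None.
Proof.
move=> Ev; rewrite /move insubF // -[nat_of_ord _]/(level v) Ev.
by have := level_lt v; lia.
Qed.

Lemma move_down_None v : level v = 0 -> move v (true, false) = None.
Proof. by rewrite /move -[nat_of_ord _]/(level v) => ->. Qed.

Lemma imset_Some2 (v w : cyl_vertex n m) :
  Some @: [set v; w] = [set Some v; Some w].
Proof. by rewrite imsetU1 imset_set1. Qed.

Lemma wired_edgeP (e : {set wired_vertex n m}) :
  reflect (exists v d, e = [set Some v; move v d]) (e \in wired_edges n m).
Proof.
apply: (iffP idP) => [|[v [d ->]]]; rewrite inE => /=.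
  case/orP=> /imsetP[]; last first.
    move=> v; rewrite !inE => /orP[] /eqP Ev ->; exists v; rewrite setUC.
      by exists (true, false); rewrite move_down_None.
    by exists (true, true); rewrite move_up_None.
  move=> e'; rewrite inE => /orP[/imsetP[v _ ->]|/imset2P[u v _ uv ->]] ->.
    by exists v, (false, true); rewrite imset_Some2.
  rewrite imset_Some2; exists u, (true, true).
  by case/andP: uv => /eqP E1 /eqP E2; rewrite (@move_to_up _ v).
have around_edge u : Some @: [set u; around u] \in
    [set Some @: (e : {set cyl_vertex n m}) | e in cyl_edges n m].
  by apply: imset_f; rewrite inE; apply/orP; left; apply: imset_f.
have axial_edge u w : w.1 = u.1 -> level w = (level u).+1 ->
    Some @: [set u; w] \in
    [set Some @: (e : {set cyl_vertex n m}) | e in cyl_edges n m].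
  move=> E1 E2; apply: imset_f; rewrite inE; apply/orP; right.
  by apply/imset2P; exists u w => //;
    rewrite -topredE /= /axial_step E1 eqxx; apply/eqP.
case: (moveP v d) => [[] w El E1|w El E1|w El E1|E|E]; apply/orP.
- left; rewrite (_ : w = around v) -?imset_Some2 //.
  exact: vertex_ext.
- left; rewrite setUC (_ : v = around w) -?imset_Some2 //.
  by apply: vertex_ext; [rewrite /= E1 ord_predK | rewrite level_around].
- by left; rewrite -imset_Some2; apply: axial_edge.
- by left; rewrite setUC -imset_Some2; apply: axial_edge.
- right; rewrite setUC; apply/imsetP; exists v => //; rewrite !inE.
  by apply/orP; right; apply/eqP; rewrite -[nat_of_ord _]/(level v); lia.
- by right; rewrite setUC; apply/imsetP; exists v => //;
    rewrite !inE; apply/orP; left; apply/eqP.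
Qed.

Lemma edge_move v (x : wired_vertex n m) : [set Some v; x] \in wired_edges n m ->
  exists d, move v d = x.
Proof.
case/wired_edgeP=> u [d /set2_eq[[[->] ->]|[Ev ->]]]; first by exists d.
by exists (d.1, ~~ d.2); apply: move_rev.
Qed.

Hypotheses (n_gt2 : 2 < n) (m_gt1 : 1 < m).

Lemma ordS_neq (i : 'I_n) : ordS i != i.
Proof.
apply/eqP => /(congr1 val) /=; have := ltn_ord i; rewrite leq_eqVlt.
case/orP => [/eqP E|lt_i]; first by rewrite E modnn; lia.
by rewrite modn_small //; lia.
Qed.

(** Equality would mean [i + 2 = i] modulo [n], which [n > 2] excludes. *)
Lemma ordS_ord_pred_neq (i : 'I_n) : ordS i != ord_pred i.
Proof.
apply/eqP => E; have := congr1 (@ordS n) E; rewrite ord_predK.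
move/(congr1 val) => /=; have i_lt := ltn_ord i.
have [lt_i|le_i] := ltnP i.+2 n.
  by rewrite !(@modn_small _ n) /=; lia.
have [Ei|Ei]: i.+1 = n \/ i.+2 = n by lia.
  by rewrite Ei modnn modn_small; lia.
by rewrite (@modn_small i.+1) ?Ei ?modnn; lia.
Qed.

Lemma move_neq v d : move v d != Some v.
Proof.
case: moveP => // [b w|w|w] El E1; apply/eqP => -[Ew]; subst; try lia.
case: b E1 => /eqP; first by rewrite eq_sym (negPf (ordS_neq _)).
by rewrite -(inj_eq (can_inj (@ordSK n))) ord_predK (negPf (ordS_neq _)).
Qed.

(** [n > 2] separates the two steps around the ring, and [m > 1] the two steps to the sink. *)
Lemma move_inj v : injective (move v).
Proof.
move=> d c; case: (moveP v d) => [b w|w|w||];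
  case: (moveP v c) => [b' w'|w'|w'||] //; try by move=> *; exfalso; lia.
- move=> El E1 El' E1' [Ew]; subst w'; congr pair.
  have := ordS_ord_pred_neq v.1; rewrite E1 in E1'.
  by case: b b' E1' {E1} => [] [] // ->; rewrite eqxx.
all: by move=> E1 E2 E3 E4 [Ew]; exfalso; subst; lia.
Qed.

(** * Spanning trees as valid direction maps *)

Definition next f (s : wired_vertex n m) : wired_vertex n m :=
  obind (fun v => move v (f v)) s.

Definition tree_of f : {set {set wired_vertex n m}} :=
  [set [set Some v; move v (f v)] | v : cyl_vertex n m].

Lemma tree_of_edge f v : [set Some v; move v (f v)] \in tree_of f.
Proof. exact: imset_f. Qed.

Lemma tree_of_sub f : tree_of f \subset wired_edges n m.
Proof.
by apply/subsetP => _ /imsetP[v _ ->]; apply/wired_edgeP; exists v, (f v).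
Qed.

Lemma adj_tree_of f s t : adj (tree_of f) s t ->
  (s != None /\ next f s = t) \/ (t != None /\ next f t = s).
Proof.
by case/imsetP=> v _ /set2_eq[[-> ->]|[-> ->]]; [left | right].
Qed.

(** [h] counts the steps to the sink. *)
Lemma valid_depth f : valid f ->
  exists h : wired_vertex n m -> nat, forall v, h (next f (Some v)) < h (Some v).
Proof.
move=> f_valid; have ex_k s : exists k, iter k (next f) s == None.
  case: s => [v|]; last by exists 0.
  have [b] := f_valid v; elim=> {}v; first by move=> _ E _; exists 1; apply/eqP.
  by move=> w _ E _ [k Ek]; exists k.+1; rewrite iterSr /= E.
exists (fun s => ex_minn (ex_k s)) => v.
case: ex_minnP => k Ek k_min; case: ex_minnP => -[//|j Ej _].
by rewrite ltnS k_min // -iterSr.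
Qed.

Lemma valid_ind f (Q : wired_vertex n m -> Prop) : valid f -> Q None ->
  (forall v, Q (next f (Some v)) -> Q (Some v)) -> forall s, Q s.
Proof.
move=> f_valid Q0 QS; have [h hP] := valid_depth f_valid.
by move=> s; have [k] := ubnP (h s); elim: k s => // k IH [v|//] lt_k;
  apply: QS; apply: IH; apply: leq_trans (hP v) _.
Qed.

Lemma tree_of_connected f : valid f -> connected_graph (tree_of f).
Proof.
move=> f_valid; have to_sink: forall s, connect (adj (tree_of f)) s None.
  apply: (valid_ind f_valid) => // v; apply: connect_trans.
  exact/connect1/tree_of_edge.
apply/forallP => s; apply/forallP => t; apply: connect_trans (to_sink s) _.
by rewrite sym_connect_sym //; apply: adj_sym.
Qed.

(* On a cycle, both neighbours of a vertex of maximal depth are its successor. *)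
Lemma tree_of_acyclic f : valid f -> acyclic_graph (tree_of f).
Proof.
move=> /valid_depth[h hP]; apply/negP => /existsP[k /existsP[[c /= /eqP Ec]]].
case/andP=> k_gt2 /andP[c_cycle c_uniq].
have c_n0 : 0 < size c by rewrite Ec; lia.
have [s sc s_max] : exists2 s, s \in c & forall t, t \in c -> h t <= h s.
  have s0c : head None c \in c by rewrite -nth0 mem_nth.
  by case: (@arg_maxnP _ _ (mem c) h s0c) => s sc s_max; exists s.
have [i c' Ec'] := rot_to sc.
have s_next t : t \in c -> adj (tree_of f) s t -> t = next f s.
  move=> tc /adj_tree_of[[_ <-]//|[]]; case: t tc => // v vc _ Es.
  by have := s_max _ vc; rewrite -Es leqNgt hP.
have size_c' : (size c').+1 = k by rewrite -Ec -(size_rot i c) Ec'.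
have sub_c' : {subset c' <= c}.
  by move=> t tc'; rewrite -(mem_rot i c) Ec' inE tc' orbT.
move: c_cycle c_uniq; rewrite -(rot_cycle i _ c) -(rot_uniq i c) Ec' /=.
(* With more than two vertices the cycle is [s, a, z, ...]; its second vertex and its last one would
   both be the successor of [s], against distinctness. *)
case: c' size_c' sub_c' {Ec'} => [|a [|z c']] /= size_c' sub_c'; try lia.
rewrite rcons_path => /andP[sa /andP[_ /andP[_ zs]]].
have Ea := s_next a (sub_c' _ (mem_head _ _)) sa.
have El : last z c' = a.
  rewrite adj_sym in zs; rewrite Ea; apply: s_next zs.
  by apply: sub_c'; rewrite inE mem_last orbT.
have -> : a \in z :: c' by rewrite -El mem_last.
by rewrite andbF.
Qed.


Lemma tree_of_spanning f : valid f ->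
  tree_of f \in spanning_trees (wired_edges n m).
Proof.
by move=> f_valid; rewrite inE tree_of_sub tree_of_connected ?tree_of_acyclic.
Qed.

(** Induction from the sink: if [f] and [g] used the edge at [v] in opposite senses, [f] would go
    back and forth between its ends, against the decrease of depth. *)
Lemma tree_of_inj f g : valid f -> valid g -> tree_of f = tree_of g -> f = g.
Proof.
move=> f_valid g_valid Efg; have [h hP] := valid_depth f_valid.
have Enext: forall s, next f s = next g s.
  apply: (valid_ind f_valid) => // v IHv.
  have /imsetP[u _ /set2_eq[[[->] //]|[Ev Eu]]] :
      [set Some v; next f (Some v)] \in tree_of g.
    by rewrite -Efg tree_of_edge.
  have := hP v; have := hP u; rewrite Eu in IHv *; rewrite IHv /= -Ev.
  by move=> /ltn_trans h_trans /h_trans; rewrite ltnn.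
apply/ffunP => v; apply: (@move_inj v).
exact: (Enext (Some v)).
Qed.

(** Directing each vertex along a shortest path of [T] to the sink gives a valid map. Its tree is a
    connected spanning subgraph of the acyclic [T], hence equal to it. *)
Lemma tree_of_surj T : T \in spanning_trees (wired_edges n m) ->
  exists2 f, valid f & tree_of f = T.
Proof.
rewrite inE => /and3P[/subsetP T_sub T_conn T_acyc].
have ex_k s : exists k, [exists p : k.-tuple (wired_vertex n m),
    path (adj T) s p && (last s p == None)].
  have /connectP[p p_path Ep]: connect (adj T) s None.
    by move/forallP: T_conn => /(_ s)/forallP.
  by exists (size p); apply/existsP; exists (in_tuple p); rewrite p_path /= -Ep.
(* Distance to the sink in [T]. *)
pose h s := ex_minn (ex_k s).
have ex_d v : exists d, (h (move v d) < h (Some v)) && ([set Some v; move v d] \in T).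
  rewrite {2}/h; case: ex_minnP => k /existsP[[[|t p] /= /eqP <-]] // + _.
  case/andP=> /andP[vt t_path] t_last; have [d Ed] := edge_move (T_sub _ vt).
  exists d; rewrite Ed [_ \in _]vt andbT ltnS /h; case: ex_minnP => j _; apply.
  by apply/existsP; exists (in_tuple p); rewrite t_path.
have [f fP] : exists f : dirmap, forall v,
    h (move v (f v)) < h (Some v) /\ [set Some v; move v (f v)] \in T.
  exists [ffun v => xchoose (ex_d v)] => v; rewrite ffunE.
  by have /andP := xchooseP (ex_d v).
have f_valid : valid f.
  move=> v; have [k] := ubnP (h (Some v)); elim: k v => // k IH v lt_k.
  have [lt_h _] := fP v; case E: (move v (f v)) lt_h => [w|] lt_h.
    have [|b Eb] := IH w; first exact: leq_trans lt_h _.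
    by exists b; apply: exits_step E Eb.
  by exists (f v).2; apply: exits_here.
have f_sub : tree_of f \subset T.
  by apply/subsetP => _ /imsetP[v _ ->]; have [] := fP v.
exists f => //; apply/eqP; rewrite eqEsubset f_sub; apply/subsetP => e Te.
have /wired_edgeP[v [d Ee]] := T_sub e Te; rewrite Ee in Te *.
apply: connected_sub_acyclic f_sub (tree_of_connected f_valid) T_acyc _ Te.
by rewrite eq_sym move_neq.
Qed.

(** * Labels as exits of paths *)

Lemma tree_path_next f s t p : path (adj (tree_of f)) s (t :: p) ->
  uniq (s :: t :: p) -> last t p = None -> next f s = t.
Proof.
elim: p s t => [|r p IH] s t /andP[/adj_tree_of st t_path] st_uniq Elast.
  by case: st => -[] //; rewrite [t]Elast eqxx.
case: st => -[] // _ Et; have Er : next f t = r.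
  by apply: IH Elast => //; case/andP: st_uniq.
(* An edge taken against [f] would be retraced by the next step, visiting [s] twice. *)
by move: st_uniq; rewrite -Et Er /= !inE eqxx orbT.
Qed.

Lemma exits_at_exits f v w : exits_at (tree_of f) v w ->
  move w (f w) = None /\ exits f predT (f w).2 v.
Proof.
case/existsP=> k /existsP[[p _] /= /andP[/and3P[]]].
elim: p v => // t p IH v p_path p_uniq /eqP p_last Ew.
have Et := tree_path_next p_path p_uniq p_last.
case: t => [u|] in p_path p_uniq p_last Ew Et *; last first.
  (* The path steps into the sink and stops there, as the sink occurs only once. *)
  case: p p_last p_uniq Ew {IH p_path} => [_ _|r p /= <-].
    by move=> /= /eqP[<-]; split=> //; apply: exits_here.
  by rewrite mem_last !andbF.
have [||//|//|Ew0 Eu] := IH u.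
- by case/andP: p_path.
- by case/andP: p_uniq.
- exact/eqP.
- by case: p p_last Ew {IH p_path p_uniq}.
by split=> //; apply: exits_step Eu.
Qed.

Lemma left_labelled_exits f v :
  v \in left_labelled (tree_of f) -> exits f predT false v.
Proof.
rewrite inE => /existsP[w]; rewrite inE => /andP[/eqP w0 /exits_at_exits[Ew]].
have [_] := move_out Ew; rewrite [level w]w0.
(* An upward exit from ring 0 would force [m = 1]. *)
by case: (f w).2 => //; lia.
Qed.

Lemma right_labelled_exits f v :
  v \in right_labelled (tree_of f) -> exits f predT true v.
Proof.
rewrite inE => /existsP[w]; rewrite inE => /andP[/eqP w0 /exits_at_exits[Ew]].
have [_] := move_out Ew; rewrite [level w]w0.
by case: (f w).2 => //; lia.
Qed.

(** * Length of the slash *)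

Lemma card_levels a k :
  #|[set v : cyl_vertex n m | a <= (level v).+1 <= a + k]| <= n * k.+1.
Proof.
pose F v := (v.1, inord (n' := k) ((level v).+1 - a)).
rewrite -[X in X * _]card_ord -[k.+1]card_ord -card_prod.
rewrite -(@card_in_imset _ _ F) ?max_card // => v w.
rewrite !inE => /andP[av vk] /andP[aw wk] [E1 /(congr1 val)].
by rewrite /= !inordK; [move=> E2; apply: (vertex_ext E1); lia | lia..].
Qed.

Lemma cyl_edgeP (e : {set cyl_vertex n m}) : e \in cyl_edges n m ->
  exists v b, e = [set v; odflt v (move v (b, true))].
Proof.
rewrite inE => /orP[/imsetP[v _ ->]|/imset2P[u v _ uv ->]].
  by exists v, false.
case/andP: uv => /eqP E1 /eqP E2; exists u, true.
by rewrite (@move_to_up _ v).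
Qed.

Lemma move_up_level v w : move v (true, true) = Some w -> level w = (level v).+1.
Proof. by rewrite /move; case: insubP => // i _ Ei [<-]. Qed.

(** Let [v] be a lowest right-labelled vertex. With no band, left-labelled vertices lie at most [k]
    rings above it, so each slash edge is recorded by a vertex in one of the [k.+2] rings from
    [level v - 1] on, with at most two edges per vertex. *)
Lemma card_slash f k : ~ (exists a, band f k a) ->
  #|slash_LR (tree_of f)| <= n * k.+2 * 2.
Proof.
move=> no_band; have [->|[e0]] := set_0Vmem (slash_LR (tree_of f)).
  by rewrite cards0.
rewrite inE => /andP[_ /imset2P[_ v0 _ v0R _]].
have [v vR v_min] : exists2 v, v \in right_labelled (tree_of f) &
    forall w, w \in right_labelled (tree_of f) -> level v <= level w.
  by case: (arg_minnP level v0R) => v; exists v.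
pose X := [set w : cyl_vertex n m | level v <= (level w).+1 <= level v + k.+1].
pose F (wb : cyl_vertex n m * bool) :=
  [set wb.1; odflt wb.1 (move wb.1 (wb.2, true))].
have sub : slash_LR (tree_of f) \subset F @: setX X setT.
  apply/subsetP => e; rewrite inE => /andP[/cyl_edgeP[w [b Ee]] /imset2P[x y xL yR]].
  have y_ge := v_min _ yR; have x_le : level x <= level v + k.
    rewrite leqNgt; apply/negP => lt_x; apply: no_band; exists (level v), v, x.
    by split=> //; [exact: right_labelled_exits | exact: left_labelled_exits].
  rewrite Ee => Exy; apply/imsetP; exists (w, b) => //; rewrite !inE andbT /=.
  have [w_le le_w] : level w <= level (odflt w (move w (b, true))) /\
     level (odflt w (move w (b, true))) <= (level w).+1.
    case: b {Ee Exy} => //; case E: (move w (true, true)) => [z|//].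
    by rewrite /= (move_up_level E).
  by case: (set2_eq Exy) => -[? ?]; subst; lia.
apply: leq_trans (subset_leq_card sub) _; apply: leq_trans (leq_imset_card _ _) _.
by rewrite cardsX cardsT card_bool leq_mul2r card_levels.
Qed.

(** Long slashes come from maps with a band, and valid maps give distinct spanning trees, so the
    count of maps passes to trees. *)
Lemma card_long_slash k l : n * k.+2 * 2 <= l ->
  #|[set T in spanning_trees (wired_edges n m) | l < #|slash_LR T|]|
     * (4 ^ n).+1 ^ k <=
  #|spanning_trees (wired_edges n m)| * (4 ^ n * (4 ^ n) ^ k).
Proof.
move=> le_l; set A := [set T in _ | _].
have sub1 : A \subset tree_of @: longs k.
  apply/subsetP => T; rewrite inE => /andP[/tree_of_surj[f f_valid <-] lt_l].
  apply: imset_f; rewrite inE; apply/asboolP; split=> //.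
  apply/not_existsP => no_band; have := @card_slash f k.
  by move/(_ (fun H => let: ex_intro a B := H in no_band a B)); lia.
have sub2 : tree_of @: valids \subset spanning_trees (wired_edges n m).
  apply/subsetP => _ /imsetP[f + ->]; rewrite inE => /asboolP.
  exact: tree_of_spanning.
have inj2 : {in valids &, injective tree_of}.
  by move=> f g; rewrite !inE => /asboolP ? /asboolP ?; apply: tree_of_inj.
have := subset_leq_card sub2; rewrite (card_in_imset inj2) => le2.
have le1 := leq_trans (subset_leq_card sub1) (leq_imset_card _ _).
apply: leq_trans (leq_mul le1 (leqnn _)) _.
by apply: leq_trans (card_longs k) _; rewrite leq_mul2r le2 orbT.
Qed.

End DirectionMaps.

(** * Numerical estimates and the exponential bound *)

Local Open Scope ring_scope.

(** Bernoulli's inequality; the inductive step leaves the surplus [k * x ^ 2]. *)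
Lemma bernoulli_sub (R : realFieldType) (x : R) k :
  0 <= x <= 1 -> 1 - k%:R * x <= (1 - x) ^+ k.
Proof.
case/andP=> x_ge0 x_le1; elim: k => [|k IH]; first by rewrite mul0r subr0 expr0.
have k_ge0 : 0 <= k%:R :> R by [].
have le_mul := ler_wpM2r (_ : 0 <= 1 - x) IH.
rewrite exprSr; apply: le_trans (le_mul _); last by rewrite subr_ge0.
rewrite -natr1 -subr_ge0.
have -> : (1 - k%:R * x) * (1 - x) - (1 - (k%:R + 1) * x) = k%:R * x * x by ring.
by rewrite !mulr_ge0.
Qed.

Lemma unif_prob_le1 (R : realType) (X : finType) (A : {set X}) (P : pred X) :
  unif_prob R A P <= 1.
Proof.
rewrite /unif_prob; have [->|A_n0] := eqVneq #|A| 0; first by rewrite invr0 mulr0.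
rewrite ler_pdivrMr ?ltr0n ?lt0n // mul1r ler_nat subset_leq_card //.
by apply/subsetP => x; rewrite inE => /andP[].
Qed.

Theorem theorem3 (R : realType) (n : nat) (hn : (3 <= n)%N) :
  exists C delta : R,
    [/\ 0 < C, 0 < delta, delta < 1 &
      forall m : nat, (2 <= m)%N ->
      forall l : nat, (1 <= l)%N ->
        unif_prob R (spanning_trees (wired_edges n m))
          (fun T => (l < #|slash_LR T|)%N) <= C * delta ^+ l].
Proof.
pose c : R := (4 ^ n)%:R; pose N := (n * 2)%N.
have c_ge1 : 1 <= c by rewrite ler1n expn_gt0.
have N_ge1 : 1 <= N%:R :> R by rewrite ler1n; lia.
(* Chosen so that [delta ^ N >= 1 - N * e = c / (c + 1)] by Bernoulli. *)
pose e := ((c + 1) * N%:R)^-1; pose delta := 1 - e.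
have den_gt1 : 1 < (c + 1) * N%:R.
  by rewrite (lt_le_trans (_ : 1 < c + 1)) ?ltrDr ?ler_peMr //; lra.
have e_gt0 : 0 < e by rewrite invr_gt0 (lt_trans ltr01).
have e_lt1 : e < 1 by rewrite invf_lt1 // (lt_trans ltr01).
have delta_gt0 : 0 < delta by rewrite subr_gt0.
have delta_lt1 : delta < 1 by rewrite ltrBlDr ltrDl.
have deltaX_le i j : (i <= j)%N -> delta ^+ j <= delta ^+ i.
  by move=> le_ij; rewrite ler_wiXn2l // ltW.
have ratio_le : c / (c + 1) <= delta ^+ N.
  apply: le_trans (bernoulli_sub _ (_ : 0 <= e <= 1)); last by rewrite !ltW.
  rewrite le_eqVlt /e invfM mulrCA divff; last by rewrite gt_eqF //; lra.
  by apply/orP; left; apply/eqP; field; lra.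
(* The factor [c] comes from ring [a.+1], which is always rerouted; [delta ^ (N * 3)] pays for the
   gap between [l] and [N * k]. *)
exists (c / delta ^+ (N * 3)), delta; split=> // [|m m_gt1 l _].
  by rewrite divr_gt0 ?exprn_gt0 //; lra.
(* For [l < N * 2] the right side is at least 1. *)
have [lt_l|le_l] := ltnP l (N * 2).
  apply: le_trans (unif_prob_le1 _ _ _) _.
  rewrite mulrAC ler_pdivlMr ?exprn_gt0 // mul1r.
  apply: le_trans (ler_peMl (ltW (exprn_gt0 _ _)) c_ge1) => //.
  by apply: deltaX_le; lia.
(* The largest [k] with [N * (k + 2) <= l]; here [l %/ N >= 2]. *)
pose k := (l %/ N - 2)%N.
have N_gt0 : (0 < N)%N by lia.
have k_le : (n * k.+2 * 2 <= l)%N.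
  rewrite -mulnAC -/N mulnC -leq_divRL //.
  by have : (2 <= l %/ N)%N; [rewrite leq_divRL // mulnC | lia].
have l_lt : (l <= N * 3 + N * k)%N.
  have := divn_eq l N; have := ltn_pmod l N_gt0.
  have : (2 <= l %/ N)%N by rewrite leq_divRL // mulnC.
  rewrite /k; move: (l %/ N)%N => d; nia.
have bound : unif_prob R (spanning_trees (wired_edges n m))
    (fun T => (l < #|slash_LR T|)%N) <= c * (c / (c + 1)) ^+ k.
  have := card_long_slash hn m_gt1 k_le; rewrite -(ler_nat R) /unif_prob.
  set b := #|[set _ in _ | _]|; set t := #|spanning_trees _|.
  rewrite !natrM (natrX _ (4 ^ n)%N) (natrX _ (4 ^ n).+1) -natr1 -/c => le_bt.
  have [->|t_n0] := eqVneq t 0; first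
    by rewrite invr0 mulr0 mulr_ge0 ?exprn_ge0 ?divr_ge0; lra.
  rewrite ler_pdivrMr ?ltr0n ?lt0n // expr_div_n mulrA mulrAC ler_pdivlMr; last first.
    by rewrite exprn_gt0 //; lra.
  by rewrite [leRHS]mulrC.
apply: le_trans bound _; rewrite -mulrA ler_wpM2l ?(le_trans ler01) //.
rewrite [leRHS]mulrC ler_pdivlMr ?exprn_gt0 //.
(* Each factor [c / (c + 1)] is at most [delta ^ N], and [N * k + N * 3 >= l]. *)
apply: le_trans (_ : (delta ^+ N) ^+ k * delta ^+ (N * 3) <= _).
  rewrite ler_wpM2r ?exprn_ge0 ?(ltW delta_gt0) // lerXn2r //.
    by rewrite nnegrE divr_ge0; lra.
  by rewrite nnegrE exprn_ge0 ?(ltW delta_gt0).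
by rewrite -exprM -exprD deltaX_le // addnC.
Qed.
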